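(* Let $R=(X,s)$ be a rack, and let $C:=C_{\operatorname{Aut}R}(\operatorname{Inn}R)$ be the centralizer of $\operatorname{Inn}R$ in $\operatorname{Aut}R$. Let $U_R$ be the set of GL-structures on $R$, and let $\sim$ be the equivalence relation on $U_R$ defined by $\mathtt{u}_1\sim\mathtt{u}_2$ if and only if $(R,\mathtt{u}_1)\cong(R,\mathtt{u}_2)$ as GL-racks. Then $U_R=C$, and $U_R$ is a normal subgroup of $\operatorname{Aut}R$. Furthermore, for all $\mathtt{u}_1,\mathtt{u}_2\in U_R$, we have $\mathtt{u}_1\sim\mathtt{u}_2$ if and only if $\mathtt{u}_1$ and $\mathtt{u}_2$ are conjugate in $\operatorname{Aut}R$. In particular, if $\operatorname{Aut}R$ is abelian, then $U_R=U_R/{\sim}=\operatorname{Aut}R$ (where $U_R=U_R/{\sim}$ means that every $\sim$-class is a singleton).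
   Context: For a set $X$, $S_X$ is the group of permutations of $X$; products of maps denote composition. A rack is a pair $(X,s)$ of a set $X$ and a map $s:X\to S_X$, $x\mapsto s_x$, such that $s_xs_y=s_{s_x(y)}s_x$ for all $x,y\in X$. A rack homomorphism $(X,s)\to(Y,t)$ is a map $\varphi:X\to Y$ with $\varphi s_x=t_{\varphi(x)}\varphi$ for all $x\in X$; isomorphisms are bijective homomorphisms. $\operatorname{Aut}R$ is the group of rack automorphisms of $R=(X,s)$, and $\operatorname{Inn}R:=\langle s_x\mid x\in X\rangle\leq\operatorname{Aut}R$. A GL-structure on $R$ is an automorphism $\mathtt{u}\in\operatorname{Aut}R$ such that $\mathtt{u}s_x=s_x\mathtt{u}$ for all $x\in X$; the pair $(R,\mathtt{u})$ is called a GL-rack. A GL-rack homomorphism $(R_1,\mathtt{u}_1)\to(R_2,\mathtt{u}_2)$ is a rack homomorphism $\varphi:R_1\to R_2$ with $\varphi\mathtt{u}_1=\mathtt{u}_2\varphi$; isomorphisms of GL-racks are bijective GL-rack homomorphisms. *)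

(* Defs.v *)
From HB Require Import structures.
From mathcomp Require Import all_boot.
From mathcomp Require Import boolp classical_sets.

Set Implicit Arguments.
Unset Strict Implicit.
Unset Printing Implicit Defensive.

Local Open Scope classical_set_scope.
Local Open Scope group_scope.

(* X is an arbitrary, possibly infinite or empty, type, so fingroup's {perm X}
   does not apply. *)
Record sym (X : Type) := Sym {
  sym_fun :> X -> X;
  sym_bij : bijective sym_fun }.

Section SymGroup.
Variable X : Type.
Implicit Types f g h : sym X.

Lemma symP f g : f =1 g -> f = g.
Proof.
case: f g => [f fb] [g gb] /= /funext fg; case: _ / fg gb => gb.
by congr Sym; exact: Prop_irrelevance.
Qed.

HB.instance Definition _ := gen_eqMixin (sym X).
HB.instance Definition _ := gen_choiceMixin (sym X).

Definition sym_one : sym X :=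
  Sym (@Bijective _ _ id id (fun=> erefl) (fun=> erefl)).

Definition sym_mul f g : sym X := Sym (bij_comp (sym_bij f) (sym_bij g)).

Lemma sym_inv_subproof f : exists g : sym X, cancel f g /\ cancel g f.
Proof.
case: (sym_bij f) => g fK gK.
by exists (Sym (Bijective gK fK)).
Qed.

Definition sym_inv f : sym X := sval (cid (sym_inv_subproof f)).

Lemma sym_funK f : cancel f (sym_inv f).
Proof. by rewrite /sym_inv; case: cid => g []. Qed.

Lemma sym_invK f : cancel (sym_inv f) f.
Proof. by rewrite /sym_inv; case: cid => g []. Qed.

Lemma sym_mulA : associative sym_mul.
Proof. by move=> f g h; exact: symP. Qed.

Lemma sym_mul1g : left_id sym_one sym_mul.
Proof. by move=> f; exact: symP. Qed.

Lemma sym_mulg1 : right_id sym_one sym_mul.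
Proof. by move=> f; exact: symP. Qed.

Lemma sym_mulVg : left_inverse sym_one sym_inv sym_mul.
Proof. by move=> f; apply: symP => x; exact: sym_funK. Qed.

Lemma sym_mulgV : right_inverse sym_one sym_inv sym_mul.
Proof. by move=> f; apply: symP => x; exact: sym_invK. Qed.

HB.instance Definition _ := isGroup.Build (sym X)
  sym_mulA sym_mul1g sym_mulg1 sym_mulVg sym_mulgV.

(* Products in S_X are composed from right to left, contrary to perm.v. *)
Lemma symM f g x : (f * g) x = f (g x). Proof. by []. Qed.

Lemma sym1 x : (1 : sym X) x = x. Proof. by []. Qed.

Lemma symK f : cancel f f^-1. Proof. exact: sym_funK. Qed.

Lemma symVK f : cancel f^-1 f. Proof. exact: sym_invK. Qed.

End SymGroup.

Section Subgroups.
Variable T : groupType.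
Implicit Types G H N S : set T.

Definition subgroup H := group_closed (mem H).

Definition generated S : set T := smallest subgroup S.

Definition centralizer G H : set T :=
  [set g | G g /\ forall h, H h -> commute g h].

Definition normal_subgroup N G :=
  [/\ subgroup N, N `<=` G & forall g x, G g -> N x -> N (x ^ g)].

Definition conjugate_in G (x y : T) := exists2 g, G g & y = x ^ g.

Definition abelian G := forall x y, G x -> G y -> commute x y.

Lemma subgroupP H :
  subgroup H <-> H 1 /\ forall x y, H x -> H y -> H (x / y).
Proof.
split=> -[]; rewrite ?inE => H1 HD; split; rewrite ?inE //.
- by move=> x y Hx Hy; have := HD x y; rewrite !inE; exact.
- by move=> x y; rewrite !inE; exact: HD.
Qed.

End Subgroups.

Record rack := Rack {
  rack_sort :> Type;
  rack_op : rack_sort -> sym rack_sort;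
  rack_axiom : forall x y,
    rack_op x * rack_op y = rack_op (rack_op x y) * rack_op x }.

Definition rack_hom (R1 R2 : rack) (phi : R1 -> R2) :=
  forall x, phi \o rack_op x = rack_op (phi x) \o phi.

Definition Aut (R : rack) : set (sym R) := [set f | rack_hom f].

Definition Inn (R : rack) : set (sym R) := generated (range (@rack_op R)).

Definition GL_structures (R : rack) : set (sym R) :=
  [set u | Aut u /\ forall x, u * rack_op x = rack_op x * u].

Record GL_rack := GLRack {
  GL_rack_rack :> rack;
  GL_rack_u : sym GL_rack_rack;
  GL_rack_uP : GL_structures GL_rack_u }.

Definition GL_hom (L1 L2 : GL_rack) (phi : L1 -> L2) :=
  rack_hom phi /\ phi \o GL_rack_u L1 = GL_rack_u L2 \o phi.

Definition GL_isomorphic (L1 L2 : GL_rack) :=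
  exists2 phi : L1 -> L2, GL_hom phi & bijective phi.

Definition GL_equiv (R : rack) (u1 u2 : sym R) :=
  exists (h1 : GL_structures u1) (h2 : GL_structures u2),
    GL_isomorphic (GLRack h1) (GLRack h2).

Definition GL_class (R : rack) (u : sym R) : set (sym R) :=
  [set v | GL_equiv u v].

Definition GL_quotient (R : rack) : set (set (sym R)) :=
  [set GL_class u | u in @GL_structures R].

Arguments Aut R : clear implicits.
Arguments Inn R : clear implicits.
Arguments GL_structures R : clear implicits.
Arguments GL_quotient R : clear implicits.

Section RackFacts.
Variable R : rack.

Lemma rack_op_Aut (x : R) : Aut R (rack_op x).
Proof.
move=> y; apply/funext => z /=.
exact: (congr1 (fun f : sym R => f z) (rack_axiom x y)).
Qed.

Lemma Aut_subgroup : subgroup (Aut R).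
Proof.
apply/subgroupP; split=> [x|f g fA gA x]; first by apply/funext.
apply/funext => y /=.
have gV : g^-1 (rack_op x y) = rack_op (g^-1 x) (g^-1 y).
  apply: (can_inj (symK g)); rewrite symVK.
  have /(congr1 (fun k => k (g^-1 y))) /= := gA (g^-1 x).
  by rewrite !symVK.
by rewrite gV; exact: (congr1 (fun k => k (g^-1 y)) (fA (g^-1 x))).
Qed.

Lemma Inn_sub_Aut : Inn R `<=` Aut R.
Proof.
apply: smallest_sub; first exact: Aut_subgroup.
by move=> _ [x _ <-]; exact: rack_op_Aut.
Qed.

Lemma GL_equiv_refl (u : sym R) : GL_structures R u -> GL_equiv u u.
Proof.
move=> uP; exists uP, uP; exists id; last by exists id.
by split.
Qed.

Lemma GL_equiv_sym (u v : sym R) : GL_equiv u v -> GL_equiv v u.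
Proof.
move=> [uP [vP [phi [/= phiR phiu] [psi phiK psiK]]]].
exists vP, uP; exists psi; last by exists phi.
split=> [x|]; apply/funext => y /=; apply: (can_inj phiK); rewrite psiK.
- have /(congr1 (fun k => k (psi y))) /= := phiR (psi x).
  by rewrite !psiK.
- have /(congr1 (fun k => k (psi y))) /= := phiu.
  by rewrite !psiK.
Qed.

Lemma GL_equiv_trans (u v w : sym R) :
  GL_equiv u v -> GL_equiv v w -> GL_equiv u w.
Proof.
move=> [uP [vP [phi [/= phiR phiu] phib]]] [vP' [wP [psi [/= psiR psiv] psib]]].
exists uP, wP; exists (psi \o phi); last exact: bij_comp.
split=> [x|]; apply/funext => y /=.
- have /(congr1 (fun k => k y)) /= -> := phiR x.
  exact: (congr1 (fun k => k (phi y)) (psiR (phi x))).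
- have /(congr1 (fun k => k y)) /= -> := phiu.
  exact: (congr1 (fun k => k (phi y)) psiv).
Qed.

End RackFacts.

(* Main.v *)
Require Import Defs.
From mathcomp Require Import all_boot.
From mathcomp Require Import boolp classical_sets.

Local Open Scope classical_set_scope.

(** Commuting with every [rack_op x] is the same as commuting with the group they generate
    ([centralizer_generated]), so the GL-structures form a centralizer. An automorphism [f]
    conjugates [rack_op x] into [rack_op (f x)] ([Aut_rack_opJ]), so conjugation by [f] only
    permutes the commutation conditions, whence normality. An isomorphism from [u] to [v] is an [f]
    in [Aut R] with [f * u = v * f], that is, a conjugation ([GL_equivP]). If [Aut R] is abelian, it
    contains and centralizes every [rack_op x], and conjugacy is equality. *)

Section Centralizers.
Set Implicit Arguments.
Unset Strict Implicit.
Local Open Scope group_scope.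
Variable T : groupType.
Implicit Types (x y : T) (G H S : set T).

Lemma subgroupV H x : subgroup H -> H x -> H x^-1.
Proof. by move=> /subgroupP[H1 HD] Hx; rewrite -[x^-1]mul1g; exact: HD. Qed.

Lemma subgroupJ H x y : subgroup H -> H x -> H y -> H (x ^ y).
Proof.
move=> sgH Hx Hy; have /subgroupP[_ HD] := sgH; have HV z := @subgroupV H z sgH.
have -> : x ^ y = y^-1 / (y^-1 / x) by rewrite conjgE invgF invgK.
by apply: (HD); [exact: HV|apply: HD => //; exact: HV].
Qed.

Lemma subgroup_centralizer G H : subgroup G -> subgroup (centralizer G H).
Proof.
move=> /subgroupP[G1 GD]; apply/subgroupP; split=> [|x y [Gx xH] [Gy yH]].
  by split=> // h _; exact/commute_sym/commute1.
split=> [|h Hh]; first exact: GD.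
by apply/commute_sym/commuteM; [|apply: commuteV]; apply/commute_sym; auto.
Qed.

(** The elements commuting with [x] form a subgroup; if it contains [S], minimality puts
    [generated S] inside it. *)
Lemma centralizer_generated G S :
  centralizer G (generated S) = centralizer G S.
Proof.
apply/seteqP; split=> x [Gx xS]; split=> // h Sh.
  by apply: xS; exact: sub_gen_smallest.
have xC : subgroup (centralizer setT [set x]).
  by apply: subgroup_centralizer; apply/subgroupP.
have SxC : S `<=` centralizer setT [set x].
  by move=> k Sk; split=> // _ ->; exact/commute_sym/xS.
by have [_ /(_ x erefl)/commute_sym] := Sh _ (conj xC SxC).
Qed.

Lemma abelian_conjugate_in G x y :
  abelian G -> G 1 -> G x -> conjugate_in G x y <-> y = x.
Proof.
move=> Gab G1 Gx; split=> [[g Gg ->]|->]; last by exists 1; rewrite ?conjg1.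
exact/conjg_fixP/commgP/Gab.
Qed.

End Centralizers.

Section GLStructures.
Set Implicit Arguments.
Unset Strict Implicit.
Local Open Scope group_scope.
Variable R : rack.
Implicit Types (u v f : sym R) (x : R).

(** Oriented so that, in [u ^ f * rack_op x], both factors become conjugates by [f]. *)
Lemma Aut_rack_opJ f x : Aut R f -> rack_op x = rack_op (f x) ^ f.
Proof.
move=> /(_ x) fx; apply: (mulgI f); rewrite -conjgC.
by apply: symP => y; exact: (congr1 (fun k => k y) fx).
Qed.

Lemma GL_structuresE : GL_structures R = centralizer (Aut R) (Inn R).
Proof.
rewrite /Inn centralizer_generated; apply/seteqP.
split=> u [uA uP]; split=> //; first by move=> _ [x _ <-]; exact: uP.
by move=> x; apply: uP; exists x.
Qed.

Lemma GL_structures_normal : normal_subgroup (GL_structures R) (Aut R).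
Proof.
split=> [|u []//|f u fA [uA uP]].
  by rewrite GL_structuresE; exact/subgroup_centralizer/Aut_subgroup.
split=> [|x]; first exact: subgroupJ (Aut_subgroup R) uA fA.
by rewrite (Aut_rack_opJ x fA) -!conjMg uP.
Qed.

Lemma GL_equivP u v : GL_structures R u -> GL_structures R v ->
  GL_equiv u v <-> conjugate_in (Aut R) u v.
Proof.
move=> uP vP; split.
  move=> [uP' [vP' [phi [/= phiR phiu] phib]]].
  pose f : sym R := Sym phib.
  have fA : Aut R f by [].
  (* Since [x ^ g] is [g^-1 * x * g], the relation [f * u = v * f] reads [v = u ^ f^-1]. *)
  exists f^-1; first exact: subgroupV (Aut_subgroup R) fA.
  apply: (mulIg f); rewrite -conjgCV.
  by apply: symP => y; exact: (congr1 (fun k => k y) (esym phiu)).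
move=> [f fA ->].
(* As [f * u ^ f = u * f], the map [f] goes from [u ^ f] to [u]. *)
apply: GL_equiv_sym.
have ufP : GL_structures R (u ^ f).
  by have [_ _] := GL_structures_normal; exact.
exists ufP, uP; exists f; last exact: sym_bij.
by split=> //; exact: (congr1 (@sym_fun R) (esym (conjgC u f))).
Qed.

End GLStructures.

Theorem theorem4p1 (R : rack) :
  [/\ GL_structures R = centralizer (Aut R) (Inn R),
      normal_subgroup (GL_structures R) (Aut R),
      forall u1 u2 : sym R, GL_structures R u1 -> GL_structures R u2 ->
        (GL_equiv u1 u2 <-> conjugate_in (Aut R) u1 u2)
    & abelian (Aut R) ->
        GL_quotient R = [set [set u] | u in GL_structures R] /\
        GL_structures R = Aut R].
Proof.
split; [exact: GL_structuresE|exact: GL_structures_normal|by move=> u1 u2; exact: GL_equivP|].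
move=> Aab; split; last first.
  apply/seteqP; split=> [u []//|u uA]; split=> // x.
  by apply: Aab => //; exact: rack_op_Aut.
have [A1 _] := (subgroupP _).1 (Aut_subgroup R).
apply: eq_imagel => u uP; apply/seteqP; split=> [v uv|_ ->].
  have [_ [vP _]] := uv.
  exact/(abelian_conjugate_in v Aab A1 uP.1)/(GL_equivP uP vP).
exact: GL_equiv_refl.
Qed.
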